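(* Let $n\ge 1$ be an integer and $0\le p\le 1$. For any probabilistic $0$-bit entanglement distillation protocol $\mathcal{P}$ that takes $n$ qubit pairs as input and outputs one qubit pair, the fidelity of $\mathcal{P}$ with respect to the depolarization error model $\mathcal{M}^{\mathsf{d}}_{n,p}$ satisfies $$F_{\mathcal{M}^{\mathsf{d}}_{n,p}}(\mathcal{P}) \;\le\; 1-\frac{p}{2}.$$
   Context: Notation. Alice and Bob each hold $n$ qubits; the $j$-th qubit of Alice and the $j$-th qubit of Bob form the $j$-th qubit pair. The Bell states are $\Phi^{\pm}=\frac{1}{\sqrt2}(|0\rangle^A|0\rangle^B\pm|1\rangle^A|1\rangle^B)$ and $\Psi^{\pm}=\frac{1}{\sqrt2}(|0\rangle^A|1\rangle^B\pm|1\rangle^A|0\rangle^B)$. Depolarization error model. The depolarization channel of parameter $p$ on one qubit is $\mathcal D(\rho)=(1-p)\rho+p\,\frac{I}{2}$. Applying it to Bob's qubit of $\Phi^+$ gives $$\rho_p=\Bigl(1-\frac{3p}{4}\Bigr)|\Phi^+\rangle\langle\Phi^+|+\frac p4\bigl(|\Phi^-\rangle\langle\Phi^-|+|\Psi^+\rangle\langle\Psi^+|+|\Psi^-\rangle\langle\Psi^-|\bigr).$$ The depolarization error model consists of a single state: $\mathcal{M}^{\mathsf d}_{n,p}=\{\rho_p^{\otimes n}\}$. Protocols. A deterministic $0$-bit protocol involves no communication: each party adjoins private ancillary qubits initialized to $|0\rangle$, performs a local quantum operation on his or her own qubits (independently of the other party), outputs one qubit and discards the rest; equivalently, Alice and Bob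 apply local quantum channels $\mathcal{E}_A$ and $\mathcal{E}_B$, each from $n$ qubits to one qubit. In a probabilistic $0$-bit protocol Alice and Bob additionally share a classical random string, independent of the input state, on which their local operations may depend; the output state $\mathcal{P}(\rho)$ is the average over the random string of $(\mathcal{E}_A\otimes\mathcal{E}_B)(\rho)$. No initial entanglement other than the input and no quantum channel between the parties is allowed. Fidelity. For a state $\sigma$ of one qubit pair, $F(\sigma)=\langle\Phi^+|\sigma|\Phi^+\rangle$. For an error model (set of states) $\mathcal M$, $F_{\mathcal M}(\mathcal P)=\min_{\rho\in\mathcal M}F(\mathcal P(\rho))$. *)

(* Defs.v *)
(* MathComp with MathComp-Analysis; complex matrices over R[i], R : realType. *)
From HB Require Import structures.
From mathcomp Require Import all_boot all_order all_algebra.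
From mathcomp Require Export complex mxtens.
From mathcomp Require Import all_classical all_reals all_analysis.
From mathcomp Require Import ring lra.

Set Implicit Arguments.
Unset Strict Implicit.
Unset Printing Implicit Defensive.

Import Order.TTheory GRing.Theory Num.Theory.

Local Open Scope classical_set_scope.
Local Open Scope complex_scope.
Local Open Scope sesquilinear_scope.
Local Open Scope ring_scope.

(* Operators on C^m (x) C^k are square matrices of size m * k; the basis vector
   |a>|b> has index mxtens_index (a, b), as in the Kronecker product *t of
   mxtens.  For n qubits, basis vectors are indexed by 'I_(2 ^ n) through binary
   digits: qubit j is the digit of weight 2 ^ j. *)

Section Channels.
Variable R : realType.
Local Notation C := R[i].

(* Over R[i], 0 <= z forces z to be real, so M is automatically Hermitian. *)
Definition psd m (M : 'M[C]_m) : Prop :=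
  forall v : 'cV[C]_m, 0 <= (v ^t* *m M *m v) 0 0.

Definition tens_map m k m' k' (E : 'M[C]_m -> 'M[C]_k)
    (F : 'M[C]_m' -> 'M[C]_k') (X : 'M[C]_(m * m')) : 'M[C]_(k * k') :=
  \sum_(a < m) \sum_(a' < m) \sum_(b < m') \sum_(b' < m')
    X (mxtens_index (a, b)) (mxtens_index (a', b')) *:
      (E (delta_mx a a') *t F (delta_mx b b')).

Definition completely_positive m k (E : 'M[C]_m -> 'M[C]_k) : Prop :=
  forall (d : nat) (X : 'M[C]_(d * m)),
    psd X -> psd (tens_map (idfun : 'M[C]_d -> 'M[C]_d) E X).

Definition trace_preserving m k (E : 'M[C]_m -> 'M[C]_k) : Prop :=
  forall X : 'M[C]_m, \tr (E X) = \tr X.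

Lemma tens_map_idE m k k' (F : 'M[R[i]]_k -> 'M[R[i]]_k') X a b a' b' :
  tens_map (idfun : 'M[R[i]]_m -> 'M[R[i]]_m) F X (mxtens_index (a, b)) (mxtens_index (a', b')) =
  \sum_(c < k) \sum_(c' < k) X (mxtens_index (a, c)) (mxtens_index (a', c')) * F (delta_mx c c') b b'.
Proof.
rewrite /tens_map summxE (bigD1 a) //= summxE (bigD1 a') //= summxE.
rewrite [X in _ + _ + X]big1 ?addr0; last first.
  move=> i ia; rewrite summxE big1 // => i' _; rewrite summxE big1 // => c _.
  rewrite summxE big1 // => c' _.
  by rewrite !mxE !mxtens_indexK /= eq_sym (negbTE ia) mul0r mulr0.
rewrite [X in _ + X]big1 ?addr0; last first.
  move=> i' ia; rewrite summxE big1 // => c _.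
  rewrite summxE big1 // => c' _.
  by rewrite !mxE !mxtens_indexK /= eq_refl andTb [a' == _]eq_sym (negbTE ia) mul0r mulr0.
apply: eq_bigr => c _; rewrite summxE; apply: eq_bigr => c' _.
by rewrite !mxE !mxtens_indexK /= !eqxx mul1r.
Qed.

Record channel m k := Channel {
  channel_map :> {linear 'M[C]_m -> 'M[C]_k};
  channel_cp : completely_positive channel_map;
  channel_tp : trace_preserving channel_map }.

(* The shared random string w is drawn from an arbitrary probability space, on
   which the two local channels are required to depend measurably. *)
Record protocol0 n := Protocol0 {
  string_display : measure_display;
  string_space : measurableType string_display;
  string_law : probability string_space R;
  alice : string_space -> channel (2 ^ n) 2;
  bob : string_space -> channel (2 ^ n) 2;
  alice_meas_Re : forall (X : 'M[C]_(2 ^ n)) i j,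
    measurable_fun setT (fun w => complex.Re (alice w X i j));
  alice_meas_Im : forall (X : 'M[C]_(2 ^ n)) i j,
    measurable_fun setT (fun w => complex.Im (alice w X i j));
  bob_meas_Re : forall (X : 'M[C]_(2 ^ n)) i j,
    measurable_fun setT (fun w => complex.Re (bob w X i j));
  bob_meas_Im : forall (X : 'M[C]_(2 ^ n)) i j,
    measurable_fun setT (fun w => complex.Im (bob w X i j)) }.

Arguments alice {n} p w.
Arguments bob {n} p w.

Definition run n (P : protocol0 n) (rho : 'M[C]_(2 ^ n * 2 ^ n)) :
    'M[C]_(2 * 2) :=
  let out w := tens_map (alice P w) (bob P w) rho in
  \matrix_(i, j)
    ((\int[string_law P]_w complex.Re (out w i j)) +i*
     (\int[string_law P]_w complex.Im (out w i j))).

End Channels.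

Arguments alice {R n} p w.
Arguments bob {R n} p w.

Section Bell.
Variable R : realType.
Local Notation C := R[i].

Definition ket (a : 'I_2) : 'cV[C]_2 := delta_mx a 0.
Definition ketAB (a b : 'I_2) : 'cV[C]_(2 * 2) := ket a *t ket b.

Definition isqrt2 : C := (Num.sqrt (2 : R))^-1%:C.

Definition Phi_plus := isqrt2 *: (ketAB 0 0 + ketAB 1 1).
Definition Phi_minus := isqrt2 *: (ketAB 0 0 - ketAB 1 1).
Definition Psi_plus := isqrt2 *: (ketAB 0 1 + ketAB 1 0).
Definition Psi_minus := isqrt2 *: (ketAB 0 1 - ketAB 1 0).

Definition ketbra m (v : 'cV[C]_m) : 'M[C]_m := v *m v ^t*.

Definition fidelity (sigma : 'M[C]_(2 * 2)) : R :=
  complex.Re ((Phi_plus ^t* *m sigma *m Phi_plus) 0 0).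

Lemma isqrt2E : isqrt2 * isqrt2^* = 2^-1%:C.
Proof.
have -> : isqrt2^* = isqrt2 by exact: conjc_real.
by rewrite /isqrt2 -rmorphM /= -expr2 exprVn sqr_sqrtr // ler0n.
Qed.

Lemma ketbraE m (v : 'cV[R[i]]_m) i j : ketbra v i j = v i 0 * (v j 0)^*.
Proof. by rewrite !mxE big_ord_recl big_ord0 addr0 !mxE. Qed.

Lemma ketABE a b c d :
  ketAB a b (mxtens_index (c, d)) 0 = ((c == a) && (d == b))%:R.
Proof. by rewrite mxE mxtens_indexK /= !mxE !andbT -natrM mulnb. Qed.

(* The minimum over the error model, as an infimum in R. *)
Definition model_fidelity n (M : set 'M[C]_(2 ^ n * 2 ^ n))
    (P : protocol0 R n) : R :=
  inf [set fidelity (run P rho) | rho in M].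

Lemma model_fidelity1 n (rho : 'M[C]_(2 ^ n * 2 ^ n)) (P : protocol0 R n) :
  model_fidelity [set rho] P = fidelity (run P rho).
Proof. by rewrite /model_fidelity image_set1 inf1. Qed.

End Bell.

Section Depolarization.
Variable R : realType.
Local Notation C := R[i].

(* The factor \tr X extends the channel linearly beyond states. *)
Definition depol (p : R) (X : 'M[C]_2) : 'M[C]_2 :=
  (1 - p)%:C *: X + (p / 2)%:C *: (\tr X)%:M.

Definition rho_depol (p : R) : 'M[C]_(2 * 2) :=
  (1 - 3 * p / 4)%:C *: ketbra (Phi_plus R) +
  (p / 4)%:C *: (ketbra (Phi_minus R) + ketbra (Psi_plus R) + ketbra (Psi_minus R)).

Lemma depol_deltaE (p : R) c c' b b' :
  depol p (delta_mx c c') b b' =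
  (1 - p)%:C * ((b == c) && (b' == c'))%:R + (p / 2)%:C * ((c == c') && (b == b'))%:R.
Proof.
rewrite !mxE; congr (_ + _ * _).
have -> : \tr (delta_mx c c' : 'M[R[i]]_2) = (c == c')%:R.
  rewrite /mxtrace (bigD1 c) //= mxE eqxx /= big1 ?addr0 // => k kc.
  by rewrite mxE (negbTE kc).
by rewrite -mulrnA mulnb.
Qed.

(* rho_depol is Phi^+ with Bob's qubit sent through the channel. *)
Lemma rho_depolE (p : R) :
  tens_map idfun (depol p) (ketbra (Phi_plus R)) = rho_depol p.
Proof.
have e := isqrt2E R.
have K (u : 'cV[R[i]]_(2 * 2)) i j :
    ketbra (isqrt2 R *: u) i j = 2^-1%:C * (u i 0 * (u j 0)^*).
  by rewrite ketbraE 2!mxE rmorphM /= -e mulrACA.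
have D1 (M N : 'cV[R[i]]_(2 * 2)) i : (M + N) i 0 = M i 0 + N i 0 by rewrite mxE.
have B1 (M N : 'cV[R[i]]_(2 * 2)) i : (M - N) i 0 = M i 0 - N i 0 by rewrite !mxE.
apply/matrixP => i j.
rewrite -(mxtens_unindexK i) -(mxtens_unindexK j).
case: (mxtens_unindex i) => a b; case: (mxtens_unindex j) => a' b' {i j}.
rewrite tens_map_idE.
have P a1 b1 a2 b2 : ketbra (Phi_plus R) (mxtens_index (a1, b1)) (mxtens_index (a2, b2))
   = 2^-1%:C * ((a1 == b1) && (a2 == b2))%:R.
  rewrite K !D1 !ketABE rmorphD /= !rmorph_nat -!natrD -natrM.
  congr (_ * _%:R).
  by case: a1 b1 a2 b2 => [[|[|//]] ?] [[|[|//]] ?] [[|[|//]] ?] [[|[|//]] ?].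
under eq_bigr do under eq_bigr do rewrite P depol_deltaE.
rewrite (bigD1 a) //= [X in _ + X = _]big1 ?addr0; last first.
  move=> c ca; rewrite big1 // => c' _.
  by rewrite [a == _]eq_sym (negbTE ca) mulr0 mul0r.
rewrite (bigD1 a') //= [X in _ + X = _]big1 ?addr0; last first.
  by move=> c ca; rewrite eqxx [a' == _]eq_sym (negbTE ca) mulr0 mul0r.
rewrite !eqxx mulr1.
have D (M N : 'M[R[i]]_(2 * 2)) i j : (M + N) i j = M i j + N i j by rewrite mxE.
have Z x (M : 'M[R[i]]_(2 * 2)) i j : (x *: M) i j = x * M i j by rewrite mxE.
have cst (m : bool) : (m%:R : R[i])^* = m%:R by rewrite rmorph_nat.
have PM : ketbra (Phi_minus R) (mxtens_index (a, b)) (mxtens_index (a', b')) =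
    2^-1%:C * ((((a == 0) && (b == 0))%:R - ((a == 1) && (b == 1))%:R) *
               (((a' == 0) && (b' == 0))%:R - ((a' == 1) && (b' == 1))%:R)).
  by rewrite K !B1 !ketABE rmorphB /= !cst.
have QP : ketbra (Psi_plus R) (mxtens_index (a, b)) (mxtens_index (a', b')) =
    2^-1%:C * ((((a == 0) && (b == 1))%:R + ((a == 1) && (b == 0))%:R) *
               (((a' == 0) && (b' == 1))%:R + ((a' == 1) && (b' == 0))%:R)).
  by rewrite K !D1 !ketABE rmorphD /= !cst.
have QM : ketbra (Psi_minus R) (mxtens_index (a, b)) (mxtens_index (a', b')) =
    2^-1%:C * ((((a == 0) && (b == 1))%:R - ((a == 1) && (b == 0))%:R) *
               (((a' == 0) && (b' == 1))%:R - ((a' == 1) && (b' == 0))%:R)).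
  by rewrite K !B1 !ketABE rmorphB /= !cst.
have RD i j : rho_depol p i j = (1 - 3 * p / 4)%:C * ketbra (Phi_plus R) i j +
    (p / 4)%:C * (ketbra (Phi_minus R) i j + ketbra (Psi_plus R) i j +
                  ketbra (Psi_minus R) i j).
  rewrite /rho_depol D; congr (_ + _); first exact: Z.
  by rewrite -2!D; exact: Z.
apply: etrans (esym _); last first.
  apply: etrans (RD _ _) _; apply: congr2; apply: congr1.
    exact: P.
  by apply: congr2 QM; apply: congr2 PM QP.
move=> {PM QP QM RD P D Z K D1 B1 cst}.
have -> : (p / 4)%:C = (p / 2)%:C * 2^-1%:C :> R[i].
  by rewrite -rmorphM /=; congr (_%:C); field.
have -> : (1 - 3 * p / 4)%:C = (1 - p)%:C + (p / 2)%:C * 2^-1%:C :> R[i].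
  by rewrite -rmorphM -rmorphD /=; congr (_%:C); field.
have -> : (1 - p)%:C = 1 - 2 * (p / 2)%:C :> R[i].
  rewrite (_ : 1 - p = 1 - (p / 2 + p / 2)); last by field.
  by rewrite rmorphB rmorphD rmorph1 /=; ring.
have -> : 2^-1%:C = 2^-1 :> R[i] by rewrite fmorphV /= rmorph_nat.
move: (p / 2)%:C => q.
by case: a b a' b' => [[|[|//]] ?] [[|[|//]] ?] [[|[|//]] ?] [[|[|//]] ?];
  rewrite /eq_op /=; field.
Qed.

Definition qubit n (j : 'I_n) (x : 'I_(2 ^ n)) : 'I_2 := inZp (x %/ 2 ^ j).

Definition qubit_pair n (j : 'I_n) (x : 'I_(2 ^ n * 2 ^ n)) : 'I_(2 * 2) :=
  mxtens_index (qubit j (mxtens_unindex x).1, qubit j (mxtens_unindex x).2).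

(* rho^{(x) n} over the n qubit pairs, with Alice's n qubits grouped as the
   left tensor factor and Bob's n qubits as the right one. *)
Definition pairs_power n (rho : 'M[C]_(2 * 2)) : 'M[C]_(2 ^ n * 2 ^ n) :=
  \matrix_(x, y) \prod_(j < n) rho (qubit_pair j x) (qubit_pair j y).

Definition depol_model n (p : R) : set 'M[C]_(2 ^ n * 2 ^ n) :=
  [set pairs_power n (rho_depol p)].

End Depolarization.

Arguments pairs_power {R} n rho.
Arguments depol_model {R} n p.

(* Main.v *)
(* Expand the input state in real Pauli strings P_mu: its entries are
   4^-n sum_mu w_mu P_mu(a,a') P_mu(b,b'), with w_mu = (1-p)^|mu| and |mu| the
   number of non-identity factors.  For fixed shared randomness twice the fidelity
   is then 4^-n sum_{s,t,mu} w_mu e_{st}(mu) f_{st}(mu), where e and f are the Pauli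
   coefficients of the Choi matrices of the two channels.  Separate e and f by
   2 Re (e f) <= |e|^2 + |f|^2 and use w_mu <= (1-p) + p [mu = identity].  By
   Parseval this leaves, for each channel, (1-p) times its Choi norm, where
   tr c^2 <= 2 * 2^n, and p times the norm of its value at the identity,
   at most 4^n. *)
Require Import Defs.
From mathcomp Require Import all_boot all_order all_algebra.
From mathcomp Require Import all_classical all_reals all_analysis.
From mathcomp Require Import measurable_realfun ring.

Set Implicit Arguments.
Unset Strict Implicit.
Unset Printing Implicit Defensive.

Import Order.TTheory GRing.Theory Num.Theory.

Local Open Scope ring_scope.

(** * Norm bounds for Choi matrices of channels with one-qubit output *)

Section Channels.
Local Open Scope complex_scope.
Local Open Scope sesquilinear_scope.
Local Open Scope ring_scope.
Variable R : realType.
Local Notation C := R[i].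

Lemma sum_mxtens (V : nmodType) d k (F : 'I_(d * k) -> V) :
  \sum_i F i = \sum_(a < d) \sum_(b < k) F (mxtens_index (a, b)).
Proof.
rewrite pair_big /= (reindex (@mxtens_index d k)) /=.
  by apply: eq_bigr => -[].
exists (@mxtens_unindex d k) => x _; [exact: mxtens_indexK|exact: mxtens_unindexK].
Qed.

Lemma sum_delta (V : pzRingType) (I : finType) (i : I) (F : I -> V) :
  \sum_j (i == j)%:R * F j = F i.
Proof.
rewrite (bigD1 i) //= eqxx mul1r big1 ?addr0 // => j ji.
by rewrite eq_sym (negbTE ji) mul0r.
Qed.

Lemma quad_formE m (M : 'M[C]_m) (v w : 'cV[C]_m) :
  (v ^t* *m M *m w) 0 0 = \sum_i \sum_j (v i 0)^* * M i j * w j 0.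
Proof.
rewrite mxE; under eq_bigr => j _ do rewrite mxE mulr_suml.
rewrite exchange_big; apply: eq_bigr => i _; apply: eq_bigr => j _.
by rewrite !mxE.
Qed.

Lemma psd_form m (M : 'M[C]_m) (f : 'I_m -> C) : psd M ->
  0 <= \sum_i \sum_j (f i)^* * M i j * f j.
Proof.
move=> /(_ (\col_i f i)); rewrite quad_formE.
by under eq_bigr do under eq_bigr do rewrite !mxE.
Qed.

(** Complete positivity read as a quadratic form: [d] is the dimension of the ancilla and [v] a test
    vector on ancilla and output. Taking [X], respectively [v], maximally entangled yields the two
    positivity lemmas below. *)
Lemma cp_form m k (E : 'M[C]_m -> 'M[C]_k) d (X : 'M[C]_(d * m))
    (v : 'I_d -> 'I_k -> C) : completely_positive E -> psd X ->
  0 <= \sum_a \sum_a' \sum_s \sum_t (v a s)^* *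
    (\sum_c \sum_c' X (mxtens_index (a, c)) (mxtens_index (a', c')) *
       E (delta_mx c c') s t) * v a' t.
Proof.
move=> cpE psdX.
have := psd_form (fun i => v (mxtens_unindex i).1 (mxtens_unindex i).2) (cpE d X psdX).
rewrite sum_mxtens; congr (0 <= _); apply: eq_bigr => a _.
rewrite exchange_big sum_mxtens; apply: eq_bigr => a' _.
rewrite exchange_big; apply: eq_bigr => s _; apply: eq_bigr => t _.
by rewrite tens_map_idE !mxtens_indexK.
Qed.

Lemma choi_form_ge0 m k (E : 'M[C]_m -> 'M[C]_k) (v : 'I_m -> 'I_k -> C) :
  completely_positive E ->
  0 <= \sum_a \sum_a' \sum_s \sum_t (v a s)^* * E (delta_mx a a') s t * v a' t.
Proof.
move=> cpE.
(* The unnormalized maximally entangled vector on ancilla and input; the channel sends its projector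
   to the Choi matrix. *)
pose w : 'cV[C]_(m * m) :=
  \col_x ((mxtens_unindex x).1 == (mxtens_unindex x).2)%:R.
have psdX : psd (\matrix_(x, y) (w x 0 * w y 0)).
  move=> u; rewrite quad_formE.
  suff -> : \sum_i \sum_j (u i 0)^* * (\matrix_(x, y) (w x 0 * w y 0)) i j * u j 0
      = (\sum_i u i 0 * w i 0) * (\sum_i u i 0 * w i 0)^* by exact: mul_conjC_ge0.
  rewrite rmorph_sum mulrC mulr_suml; apply: eq_bigr => i _.
  rewrite mulr_sumr; apply: eq_bigr => j _.
  by rewrite !mxE rmorphM rmorph_nat /= mulrCA !mulrA; ring.
have := cp_form v cpE psdX; congr (0 <= _).
do 2 (apply: eq_bigr => ? _); apply: eq_bigr => s _; apply: eq_bigr => t _.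
congr (_ * _ * _).
under eq_bigr => c _.
  under eq_bigr => c' _ do rewrite !mxE !mxtens_indexK /= -mulrA.
  rewrite -mulr_sumr sum_delta; over.
by rewrite sum_delta.
Qed.

(** Feeds [W] itself to the channel, with an ancilla the size of the output, and tests on the
    maximally entangled vector. This gives positivity of the pairing of two positive matrices
    without a square root of either. *)
Lemma choi_pairing_ge0 m k (E : 'M[C]_m -> 'M[C]_k)
    (W : 'I_k -> 'I_m -> 'I_k -> 'I_m -> C) :
  completely_positive E ->
  (forall v : 'I_m -> 'I_k -> C,
    0 <= \sum_a \sum_a' \sum_s \sum_t (v a s)^* * W s a t a' * v a' t) ->
  0 <= \sum_s \sum_t \sum_a \sum_a' W s a t a' * E (delta_mx a a') s t.
Proof.
move=> cpE psdW.
pose X : 'M[C]_(k * m) := \matrix_(x, y)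
  W (mxtens_unindex x).1 (mxtens_unindex x).2 (mxtens_unindex y).1 (mxtens_unindex y).2.
have psdX : psd X.
  move=> u; rewrite quad_formE.
  have := psdW (fun a s => u (mxtens_index (s, a)) 0); congr (0 <= _).
  rewrite sum_mxtens [RHS]exchange_big; apply: eq_bigr => a _.
  rewrite exchange_big; apply: eq_bigr => s _.
  rewrite sum_mxtens exchange_big; apply: eq_bigr => a' _; apply: eq_bigr => t _.
  by rewrite !mxE !mxtens_indexK.
have := cp_form (fun s t => (s == t)%:R) cpE psdX; congr (0 <= _).
apply: eq_bigr => s _; apply: eq_bigr => t _.
under eq_bigr => s' _.
  under eq_bigr => t' _ do rewrite rmorph_nat -mulrA [_ * (t == t')%:R]mulrC.
  rewrite -mulr_sumr sum_delta; over.
rewrite sum_delta.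
by apply: eq_bigr => a _; apply: eq_bigr => a' _; rewrite !mxE !mxtens_indexK.
Qed.

Lemma sum_ord2 (V : nmodType) (F : 'I_2 -> V) : \sum_i F i = F 0 + F 1.
Proof.
by rewrite big_ord_recl big_ord1; congr (_ + F _); apply: val_inj.
Qed.

(* Twirling the output qubit of the Choi matrix c by the Pauli group gives
   c + XcX + YcY + ZcZ = 2 I, so 2 I - c is positive and tr (c (2 I - c)) >= 0. *)
Lemma choi_norm_le m (E : 'M[C]_m -> 'M[C]_2) :
  completely_positive E -> trace_preserving E ->
  \sum_s \sum_t \sum_a \sum_a' `|E (delta_mx a a') s t| ^+ 2 <= m%:R *+ 2.
Proof.
move=> cpE tpE.
have trE a a' : E (delta_mx a a') 0 0 + E (delta_mx a a') 1 1 = (a == a')%:R.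
  have := tpE (delta_mx a a'); rewrite /mxtrace sum_ord2 => ->.
  rewrite (bigD1 a) //= mxE eqxx /=.
  by rewrite big1 ?addr0 // => k ka; rewrite mxE (negbTE ka).
(* The conjugate makes the bilinear pairing with [E] produce squared moduli; the identity part pairs
   to [2 m], twice the trace of the Choi matrix. *)
pose W s a t a' : C := ((s == t) && (a == a'))%:R *+ 2 - (E (delta_mx a a') s t)^*.
have WP : 0 <= \sum_s \sum_t \sum_a \sum_a' W s a t a' * E (delta_mx a a') s t.
  apply: choi_pairing_ge0 => // v.
  have cconj (w : 'I_m -> 'I_2 -> C) : 0 <= \sum_a \sum_a' \sum_s \sum_t
      (w a s)^* * (E (delta_mx a a') s t)^* * w a' t.
    have := choi_form_ge0 (fun a s => (w a s)^*) cpE.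
    rewrite -conjC_ge0; congr (0 <= _).
    do 4 (rewrite rmorph_sum; apply: eq_bigr => ? _).
    by rewrite !rmorphM /= !conjCK.
  (* The test vectors are the images of [v] under Z, X and, up to a phase, Y on the output qubit. *)
  have := addr_ge0 (addr_ge0
    (cconj (fun a s => if s == 0 then v a 0 else - v a 1))
    (cconj (fun a s => if s == 0 then v a 1 else v a 0)))
    (cconj (fun a s => if s == 0 then v a 1 else - v a 0)).
  congr (0 <= _).
  rewrite -!big_split; apply: eq_bigr => a _ /=.
  rewrite -!big_split; apply: eq_bigr => a' _ /=.
  have tr := congr1 Num.conj (trE a a').
  rewrite rmorphD rmorph_nat /= in tr.
  by rewrite !sum_ord2 /W /= -tr !rmorphN /=; ring.
suff e : \sum_s \sum_t \sum_a \sum_a' W s a t a' * E (delta_mx a a') s t =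
    m%:R *+ 2 - \sum_s \sum_t \sum_a \sum_a' `|E (delta_mx a a') s t| ^+ 2.
  by rewrite e subr_ge0 in WP.
have -> : m%:R *+ 2 = \sum_(s < 2) \sum_(t < 2) \sum_a \sum_a'
    ((s == t) && (a == a'))%:R *+ 2 * E (delta_mx a a') s t.
  rewrite !sum_ord2 /=.
  have z i j : \sum_a \sum_a' 0%:R *+ 2 * E (delta_mx a a') i j = 0.
    by rewrite big1 // => a _; rewrite big1 // => a' _; rewrite mul0rn mul0r.
  rewrite !z addr0 add0r {z}.
  rewrite -big_split /= -[m in LHS]card_ord -sum1_card natr_sum -sumrMnl.
  apply: eq_bigr => a _; rewrite -big_split /=.
  under eq_bigr => a' _ do rewrite -mulrDr trE mulrnAl -mulrnAr.
  by rewrite sum_delta eqxx.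
rewrite -!sumrB; do 4 (apply: eq_bigr => ? _; rewrite -?sumrB).
by rewrite /W mulrBl normCKC.
Qed.

(** For Hermitian [H] of size two the gap between the two sides is [2 det H], so the point is that
    [H] is Hermitian with nonnegative determinant. *)
Lemma psd2_norm_le (H : 'M[C]_2) : psd H ->
  \sum_s \sum_t `|H s t| ^+ 2 <= (\tr H) ^+ 2.
Proof.
move=> psdH; rewrite /mxtrace !sum_ord2.
set a := H 0 0; set b := H 0 1; set c := H 1 0; set d := H 1 1.
have h x y : 0 <= x^* * a * x + x^* * b * y + y^* * c * x + y^* * d * y.
  have := psd_form (fun i => if i == 0 then x else y) psdH.
  by rewrite !sum_ord2 /= addrA.
have a0 : 0 <= a by have := h 1 0; rewrite conjC1 conjC0 !(mul0r, mulr0, mul1r, mulr1, addr0).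
have d0 : 0 <= d by have := h 0 1; rewrite conjC1 conjC0 !(mul0r, mulr0, mul1r, mulr1, add0r).
have aJ := geC0_conj a0; have dJ := geC0_conj d0.
(* The form is real at (1,1) and (1,i); combining the two equations leaves [2 i (b^* - c) = 0]. *)
have bJ : b^* = c.
  have /geC0_conj := h 1 1; have /geC0_conj := h 1 'i%R.
  rewrite !rmorphD !rmorphM /= !conjCK conjC1 conjCi !mul1r !mulr1 aJ dJ => e1 e2.
  apply: (mulfI (_ : 2 * 'i%R != 0)); first by rewrite mulf_neq0 ?pnatr_eq0 ?neq0Ci.
  move: e1 e2; move: ('i%R : C) (b^*) (c^*) => I bJ cJ e1 e2.
  apply/eqP; rewrite -subr_eq0; apply/eqP.
  transitivity (I * (a + bJ + cJ + d - (a + b + c + d)) -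
    (a + bJ * - I + I * cJ + I * d * - I - (a + b * I + - I * c + - I * d * I))).
    by ring.
  by rewrite e1 e2 !subrr mulr0 subr0.
have cJ : c^* = b by rewrite -bJ conjCK.
have ad : b * c <= a * d.
  (* The first two vectors give [a] and [d] times the determinant; the third covers the case where
     both diagonal entries vanish. *)
  have h1 := h b (- a); have h2 := h (- d) c; have h3 := h 1 (- c).
  rewrite !(rmorphN, conjC1) /= aJ dJ bJ cJ in h1 h2 h3.
  have [a_eq0|a_neq0] := eqVneq a 0; have [d_eq0|d_neq0] := eqVneq d 0.
  - move: h3; rewrite a_eq0 d_eq0 => h3.
    have : 0 <= 2 * (0 * 0 - b * c) by move: h3; congr (0 <= _); ring.
    by rewrite pmulr_rge0 ?ltr0n // subr_ge0.
  - rewrite -subr_ge0 -(@pmulr_rge0 _ d) ?lt_def ?d_neq0 //.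
    by move: h2; congr (0 <= _); ring.
  - rewrite -subr_ge0 -(@pmulr_rge0 _ a) ?lt_def ?a_neq0 //.
    by move: h1; congr (0 <= _); ring.
  - rewrite -subr_ge0 -(@pmulr_rge0 _ a) ?lt_def ?a_neq0 //.
    by move: h1; congr (0 <= _); ring.
rewrite !normCK aJ dJ bJ cJ -subr_ge0.
suff -> : (a + d) ^+ 2 - (a * a + b * c + (c * b + d * d)) = 2 * (a * d - b * c).
  by rewrite mulr_ge0 ?ler0n ?subr_ge0.
by ring.
Qed.

(** [E 1%:M] is the sum of the diagonal blocks of the Choi matrix, hence positive, and its trace is
    [m]. *)
Lemma unital_norm_le m (E : {linear 'M[C]_m -> 'M[C]_2}) :
  completely_positive E -> trace_preserving E ->
  \sum_s \sum_t `|E 1%:M s t| ^+ 2 <= m%:R ^+ 2.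
Proof.
move=> cpE tpE; rewrite -(mxtrace1 C m) -tpE; apply: psd2_norm_le => v.
have -> : E 1%:M = \sum_a E (delta_mx a a) by rewrite mx1_sum_delta linear_sum.
rewrite mulmx_sumr mulmx_suml summxE; apply: sumr_ge0 => a _.
rewrite quad_formE.
(* A test vector supported on block [a] isolates the diagonal block [E (delta_mx a a)]. *)
have := choi_form_ge0 (fun x s => (a == x)%:R * v s 0) cpE; congr (0 <= _).
under eq_bigr => x _.
  under eq_bigr => y _.
    under eq_bigr => s _.
      under eq_bigr => t _ do rewrite mulrCA.
      rewrite -mulr_sumr; over.
    rewrite -mulr_sumr; over.
  rewrite sum_delta.
  under eq_bigr => s _.
    under eq_bigr => t _ do rewrite rmorphM rmorph_nat /= -!mulrA.
    rewrite -mulr_sumr; over.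
  rewrite -mulr_sumr; over.
rewrite sum_delta.
by apply: eq_bigr => s _; apply: eq_bigr => t _; rewrite mulrA.
Qed.

End Channels.

(** * Basis indices are determined by their qubits *)

Lemma nat_digits_inj n x y : (x < 2 ^ n)%N -> (y < 2 ^ n)%N ->
  (forall j, (j < n)%N -> x %/ 2 ^ j = y %/ 2 ^ j %[mod 2])%N -> x = y.
Proof.
elim: n x y => [|n IH] x y.
  by rewrite expn0 !ltnS !leqn0 => /eqP-> /eqP->.
rewrite expnSr => xn yn xy.
rewrite (divn_eq x 2) (divn_eq y 2); congr (_ * 2 + _)%N.
  apply: IH => [||j jn]; rewrite ?ltn_divLR //.
  by rewrite -!divnMA -expnS; exact: xy.
by have := xy 0%N isT; rewrite expn0 !divn1.
Qed.

Lemma qubit_inj n (x y : 'I_(2 ^ n)) :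
  (forall j, qubit j x = qubit j y) -> x = y.
Proof.
move=> xy; apply: val_inj; apply: (@nat_digits_inj n) (ltn_ord x) (ltn_ord y) _ => j jn.
by have /(congr1 val) := xy (Ordinal jn).
Qed.

(** * Real Pauli strings: completeness, Parseval and the noise weights *)

Section Pauli.
Local Open Scope complex_scope.
Local Open Scope sesquilinear_scope.
Local Open Scope ring_scope.
Variable R : realType.
Local Notation C := R[i].

(* (0,0), (0,1), (1,0), (1,1) index I, Z, X and, up to sign, the real matrix i Y. *)
Definition pauli (m : bool * bool) (a b : 'I_2) : C :=
  ((a != b) == m.1)%:R * (-1) ^+ (m.2 && (a == 1)).

Lemma sum_bool2 (V : nmodType) (F : bool * bool -> V) :
  \sum_m F m = F (false, false) + F (false, true) + F (true, false) + F (true, true).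
Proof.
transitivity (\sum_(a : bool) \sum_(b : bool) F (a, b)).
  by rewrite pair_big /=; apply: eq_bigr => -[].
by rewrite !big_bool /= addrC [X in X + _]addrC [X in _ + X]addrC addrA.
Qed.

(** Up to the factor [sqrt 2] the four matrices are an orthonormal basis of the 2 by 2 matrices. *)
Lemma pauli_complete a b a' b' :
  \sum_m pauli m a b * pauli m a' b' = 2 * ((a == a') && (b == b'))%:R.
Proof.
rewrite sum_bool2.
by case: a b a' b' => [[|[|//]] ?] [[|[|//]] ?] [[|[|//]] ?] [[|[|//]] ?];
  rewrite /pauli /eq_op /= /eq_op /= ?expr0 ?expr1; ring.
Qed.

Definition pauli_weight (q : C) (m : bool * bool) : C := if m.1 || m.2 then q else 1.

Lemma Phi_plusE (a b : 'I_2) :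
  Phi_plus R (mxtens_index (a, b)) 0 = isqrt2 R * (a == b)%:R.
Proof.
rewrite 2!mxE !ketABE; congr (_ * _).
by case: a b => [[|[|//]] ?] [[|[|//]] ?]; rewrite /eq_op /= ?addr0 ?add0r.
Qed.

(** The projector on Phi^+ is (II + XX - YY + ZZ)/4, and the real form of Y absorbs the minus sign.
    Depolarizing Bob's qubit fixes I and scales the other three by [1 - p]. *)
Lemma rho_depol_pauliE (p : R) a b a' b' :
  rho_depol p (mxtens_index (a, b)) (mxtens_index (a', b')) =
  4^-1 * \sum_m pauli_weight (1 - p%:C) m * (pauli m a a' * pauli m b b').
Proof.
have PE a1 b1 a2 b2 : ketbra (Phi_plus R) (mxtens_index (a1, b1)) (mxtens_index (a2, b2))
   = (a1 == b1)%:R * ((a2 == b2)%:R * 2^-1).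
  rewrite ketbraE !Phi_plusE rmorphM rmorph_nat /= mulrACA (isqrt2E R).
  by rewrite fmorphV rmorph_nat mulrC mulrA.
rewrite -rho_depolE tens_map_idE.
under eq_bigr do under eq_bigr do rewrite PE -!mulrA.
under eq_bigr do rewrite -mulr_sumr sum_delta.
rewrite sum_delta depol_deltaE sum_bool2.
have -> : (p / 2)%:C = p%:C / 2 :> C by rewrite rmorphM fmorphV rmorph_nat.
rewrite rmorphB rmorph1 /=; move: (p%:C) => r.
by case: a b a' b' => [[|[|//]] ?] [[|[|//]] ?] [[|[|//]] ?] [[|[|//]] ?];
  rewrite /pauli_weight /pauli /eq_op /= /eq_op /= ?expr0 ?expr1; field.
Qed.

Section Strings.
Variable n : nat.
Implicit Types (mu : {ffun 'I_n -> bool * bool}) (x y : 'I_(2 ^ n)).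

Definition pauli_string mu x y : C :=
  \prod_(j < n) pauli (mu j) (qubit j x) (qubit j y).

Definition string_weight (q : C) mu : C := \prod_(j < n) pauli_weight q (mu j).

Lemma pauli_string_complete x y x' y' :
  \sum_mu pauli_string mu x y * pauli_string mu x' y' =
  2 ^+ n * ((x == x') && (y == y'))%:R.
Proof.
under eq_bigr do rewrite -big_split /=.
rewrite -(bigA_distr_bigA (fun j m =>
  pauli m (qubit j x) (qubit j y) * pauli m (qubit j x') (qubit j y'))).
under eq_bigr do rewrite pauli_complete.
rewrite big_split prodr_const card_ord /=; congr (_ * _).
have [/andP[/eqP-> /eqP->]|xy] := boolP ((x == x') && (y == y')).
  by rewrite big1 // => j _; rewrite !eqxx.
apply/eqP; rewrite prodf_seq_eq0; apply/hasP.
(* Distinct index pairs differ at some qubit, whose factor in the product is zero. *)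
have [j /negbTE jP] : exists j : 'I_n,
    ~~ ((qubit j x == qubit j x') && (qubit j y == qubit j y')).
  apply/existsP; apply: contraNT xy; rewrite negb_exists => /forallP h.
  by apply/andP; split; apply/eqP; apply: qubit_inj => j;
    have := h j; rewrite negbK => /andP[/eqP ? /eqP ?].
by exists j; rewrite ?mem_index_enum //= jP.
Qed.

Lemma pairs_power_pauliE (p : R) x y x' y' :
  pairs_power n (rho_depol p) (mxtens_index (x, y)) (mxtens_index (x', y')) =
  4 ^- n * \sum_mu string_weight (1 - p%:C) mu *
    (pauli_string mu x x' * pauli_string mu y y').
Proof.
rewrite mxE; under eq_bigr do rewrite /qubit_pair !mxtens_indexK rho_depol_pauliE.
rewrite big_split prodr_const card_ord /= exprVn; congr (_ * _).
rewrite bigA_distr_bigA; apply: eq_bigr => mu _.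
by rewrite -!big_split.
Qed.

Definition pauli_coef (e : 'I_(2 ^ n) -> 'I_(2 ^ n) -> C) mu : C :=
  \sum_x \sum_y pauli_string mu x y * e x y.

Lemma conj_pauli_string mu x y : (pauli_string mu x y)^* = pauli_string mu x y.
Proof.
rewrite rmorph_prod; apply: eq_bigr => j _.
by rewrite rmorphM /= rmorph_nat rmorph_sign.
Qed.

(** Expanding the squared modulus and summing over strings first, completeness identifies the two
    index pairs. *)
Lemma parseval e :
  \sum_mu `|pauli_coef e mu| ^+ 2 = 2 ^+ n * \sum_x \sum_y `|e x y| ^+ 2.
Proof.
transitivity (\sum_x \sum_y \sum_x' \sum_y'
    (\sum_mu pauli_string mu x y * pauli_string mu x' y') * (e x y * (e x' y')^*)).
  under [in RHS]eq_bigr do under eq_bigr do under eq_bigr do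
    under eq_bigr do rewrite mulr_suml.
  under [in RHS]eq_bigr do under eq_bigr do under eq_bigr do rewrite exchange_big.
  under [in RHS]eq_bigr do under eq_bigr do rewrite exchange_big.
  under [in RHS]eq_bigr do rewrite exchange_big.
  rewrite [RHS]exchange_big; apply: eq_bigr => mu _.
  rewrite normCK rmorph_sum mulr_suml; apply: eq_bigr => x _.
  rewrite mulr_suml; apply: eq_bigr => y _.
  rewrite mulr_sumr; apply: eq_bigr => x' _.
  rewrite rmorph_sum mulr_sumr; apply: eq_bigr => y' _.
  by rewrite rmorphM /= conj_pauli_string mulrACA.
rewrite mulr_sumr; apply: eq_bigr => x _; rewrite mulr_sumr; apply: eq_bigr => y _.
under eq_bigr do under eq_bigr do rewrite pauli_string_complete -mulnb natrM -!mulrA.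
under eq_bigr do rewrite -!mulr_sumr sum_delta mulrCA.
by rewrite sum_delta -normCK.
Qed.

Definition string1 : {ffun 'I_n -> bool * bool} := [ffun=> (false, false)].

Lemma pauli_coef1 e : pauli_coef e string1 = \sum_x e x x.
Proof.
apply: eq_bigr => x _; rewrite -[RHS](sum_delta x); apply: eq_bigr => y _.
congr (_ * _); rewrite /pauli_string.
under eq_bigr do rewrite ffunE /pauli expr0 mulr1 /= eqbF_neg negbK.
have [->|xy] := eqVneq x y; first by rewrite big1 // => j _; rewrite eqxx.
apply/eqP; rewrite prodf_seq_eq0; apply/hasP.
have [j /negbTE jP] : exists j : 'I_n, qubit j x != qubit j y.
  apply/existsP; apply: contraNT xy; rewrite negb_exists => /forallP h.
  by apply/eqP; apply: qubit_inj => j; apply/eqP; have := h j; rewrite negbK.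
by exists j; rewrite ?mem_index_enum //= jP.
Qed.

Lemma string_weight_ge0 (q : C) mu : 0 <= q -> 0 <= string_weight q mu.
Proof.
by move=> q0; apply: prodr_ge0 => j _; rewrite /pauli_weight; case: ifP.
Qed.

(** A non-identity string has at least one factor [q], and its other factors are at most 1. *)
Lemma string_weight_le (q : C) mu : 0 <= q -> q <= 1 ->
  string_weight q mu <= q + (1 - q) * (string1 == mu)%:R.
Proof.
move=> q0 q1; have [<-|mu1] := eqVneq string1 mu.
  rewrite mulr1 addrC subrK /string_weight big1 // => j _.
  by rewrite ffunE.
rewrite mulr0 addr0.
have [j jP] : exists j, (mu j).1 || (mu j).2.
  apply/existsP; apply: contraNT mu1; rewrite negb_exists => /forallP h.
  apply/eqP/ffunP => j; rewrite ffunE; have := h j.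
  by case: (mu j) => [[] []].
rewrite /string_weight (bigD1 j) //= {1}/pauli_weight jP ler_piMr //.
apply: prodr_ile1 => i _; rewrite /pauli_weight; case: ifP => _;
  by rewrite ?q0 ?q1 ?ler01 ?lexx.
Qed.

(** The uniform part of the weight bound is summed by Parseval; the excess at the identity string
    sees only the trace of [e]. *)
Lemma weighted_coef_le (q : C) e : 0 <= q -> q <= 1 ->
  \sum_mu string_weight q mu * `|pauli_coef e mu| ^+ 2 <=
  q * (2 ^+ n * \sum_x \sum_y `|e x y| ^+ 2) + (1 - q) * `|\sum_x e x x| ^+ 2.
Proof.
move=> q0 q1; rewrite -parseval -pauli_coef1.
rewrite -(sum_delta string1 (fun mu => `|pauli_coef e mu| ^+ 2)) !mulr_sumr -big_split.
apply: ler_sum => mu _ /=; rewrite [X in _ + X]mulrA -mulrDl.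
by rewrite ler_wpM2r ?exprn_ge0 ?string_weight_le.
Qed.

End Strings.
End Pauli.

(** * Integrals of finite sums over the shared randomness *)

Section RintegralSum.
Local Open Scope complex_scope.
Local Open Scope ring_scope.
Context d (T : measurableType d) (R : realType) (P : probability T R).

Lemma integrable_fin_sum (I : Type) (r : seq I) (f : I -> T -> R) :
  (forall i, P.-integrable setT (EFin \o f i)) ->
  P.-integrable setT (EFin \o (fun x => \sum_(i <- r) f i x)).
Proof.
move=> intf; have -> : EFin \o (fun x => \sum_(i <- r) f i x) =
    (fun x => (\sum_(i <- r) (EFin \o f i) x)%E).
  by apply/funext => x /=; rewrite sumEFin.
exact: integrable_sum measurableT _ _ _ _ (fun i _ => intf i).
Qed.

Lemma Rintegral_sum (I : Type) (r : seq I) (f : I -> T -> R) :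
  (forall i, P.-integrable setT (EFin \o f i)) ->
  \int[P]_x (\sum_(i <- r) f i x) = \sum_(i <- r) \int[P]_x f i x.
Proof.
move=> intf; elim: r => [|i r IH].
  rewrite big_nil -[RHS](mul0r (fine (P setT))) -Rintegral_cst //.
  by apply: eq_Rintegral => x _; rewrite big_nil.
rewrite big_cons -IH -RintegralD //; last exact: integrable_fin_sum.
by apply: eq_Rintegral => x _; rewrite big_cons.
Qed.

(** Total mass 1 lets a bound valid for each fixed random string survive the averaging. *)
Lemma sum_Rintegral_le (I : finType) (f : I -> T -> R) (c : R) :
  (forall i, P.-integrable setT (EFin \o f i)) -> (forall x, \sum_i f i x <= c) ->
  \sum_i \int[P]_x f i x <= c.
Proof.
move=> intf fc; rewrite -Rintegral_sum //.
apply: (@le_trans _ _ (\int[P]_(x in setT) (cst c x))).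
  apply: le_Rintegral => //; first exact: integrable_fin_sum.
  exact: finite_measure_integrable_cst.
by rewrite Rintegral_cst //= [X in fine X]probability_setT mulr1.
Qed.

Local Notation C := R[i].

Definition complex_measurable (f : T -> C) :=
  measurable_fun setT (fun x => complex.Re (f x)) /\
  measurable_fun setT (fun x => complex.Im (f x)).

Lemma complex_measurableM f g : complex_measurable f -> complex_measurable g ->
  complex_measurable (fun x => f x * g x).
Proof.
have ReM (z w : C) : complex.Re (z * w) =
    complex.Re z * complex.Re w - complex.Im z * complex.Im w by case: z; case: w.
have ImM (z w : C) : complex.Im (z * w) =
    complex.Re z * complex.Im w + complex.Im z * complex.Re w by case: z; case: w.
move=> [rf mf] [rg mg]; split.
  by under eq_fun do rewrite ReM; apply: measurable_funB; exact: measurable_funM.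
by under eq_fun do rewrite ImM; apply: measurable_funD; exact: measurable_funM.
Qed.

Lemma complex_measurable_sum (I : finType) (f : I -> T -> C) :
  (forall i, complex_measurable (f i)) -> complex_measurable (fun x => \sum_i f i x).
Proof.
move=> mf; split.
  under eq_fun do rewrite (raddf_sum (@complex.Re R : Rcomplex R -> R)).
  by apply: measurable_sum => i; case: (mf i).
under eq_fun do rewrite (raddf_sum (@complex.Im R : Rcomplex R -> R)).
by apply: measurable_sum => i; case: (mf i).
Qed.

Lemma integrable_Re (f : T -> C) (M : C) : complex_measurable f ->
  (forall x, `|f x| <= M) -> P.-integrable setT (EFin \o (fun x => complex.Re (f x))).
Proof.
move=> [mf _] fM; apply: measurable_bounded_integrable => //.
  by rewrite [X in (X < _)%E]probability_setT ltry.
exists (complex.Re M); split; first exact: num_real.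
move=> N MN x _; apply: le_trans (ltW MN).
have := le_trans (normc_ge_Re _) (fM x).
by rewrite lecE /= => /andP[].
Qed.

End RintegralSum.

(** * Fidelity of the output and the final estimate *)

Section Distillation.
Local Open Scope complex_scope.
Local Open Scope sesquilinear_scope.
Local Open Scope ring_scope.
Variable R : realType.
Local Notation C := R[i].

(** Phi^+ has amplitude [1 / sqrt 2] on the two matched basis vectors and zero elsewhere. Both
    summation indices are packed into [u] so that a single finite sum meets the integral. *)
Lemma fidelityE (sigma : 'M[C]_(2 * 2)) : fidelity sigma =
  2^-1 * \sum_(u : 'I_2 * 'I_2)
    complex.Re (sigma (mxtens_index (u.1, u.1)) (mxtens_index (u.2, u.2))).
Proof.
rewrite /fidelity quad_formE.
transitivity (complex.Re (2^-1%:C * \sum_(u : 'I_2 * 'I_2)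
    sigma (mxtens_index (u.1, u.1)) (mxtens_index (u.2, u.2)))).
  congr complex.Re; rewrite -(pair_bigA _ (fun s t =>
    sigma (mxtens_index (s, s)) (mxtens_index (t, t)))) /= sum_mxtens mulr_sumr.
  apply: eq_bigr => s _.
  under [LHS]eq_bigr => s' _.
    under eq_bigr => j _ do rewrite Phi_plusE rmorphM rmorph_nat /= -!mulrA mulrCA.
    rewrite -mulr_sumr; over.
  rewrite sum_delta sum_mxtens mulr_sumr; apply: eq_bigr => t _.
  have mulrE (x y z w : C) : x * (y * (z * w)) = w * (z * x * y) by ring.
  by under eq_bigr => t' _ do rewrite Phi_plusE mulrE isqrt2E; rewrite sum_delta.
have ReM (x : R) (z : C) : complex.Re (x%:C * z) = x * complex.Re z.
  by case: z => u v /=; rewrite mul0r subr0.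
by rewrite ReM (raddf_sum (@complex.Re R : Rcomplex R -> R)).
Qed.

Lemma tens_mapE m k m' k' (E : 'M[C]_m -> 'M[C]_k) (F : 'M[C]_m' -> 'M[C]_k')
    (X : 'M[C]_(m * m')) s s' t t' :
  tens_map E F X (mxtens_index (s, s')) (mxtens_index (t, t')) =
  \sum_a \sum_a' \sum_b \sum_b' X (mxtens_index (a, b)) (mxtens_index (a', b')) *
    (E (delta_mx a a') s t * F (delta_mx b b') s' t').
Proof.
do 4 (rewrite summxE; apply: eq_bigr => ? _).
by rewrite mxE tensmxE.
Qed.

Section Kernel.
Variables (n : nat) (q : C).
Hypotheses (q0 : 0 <= q) (q1 : q <= 1).

Definition choi_coef (E : 'M[C]_(2 ^ n) -> 'M[C]_2) s t :=
  pauli_coef (fun a a' => E (delta_mx a a') s t).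

(** The two norm bounds combine as [q * 2^n * (2 * 2^n) + (1 - q) * 4^n]; the identity coefficients
    assemble into [E 1%:M]. *)
Lemma weighted_choi_coef_le (E : channel R (2 ^ n) 2) :
  \sum_s \sum_t \sum_mu string_weight q mu * `|choi_coef E s t mu| ^+ 2 <=
  (1 + q) * 4 ^+ n.
Proof.
have e4 : (2 ^ n)%:R * (2 ^ n)%:R = 4 ^+ n :> C by rewrite -natrM -expnMn natrX.
have sum1 : E 1%:M = \sum_a E (delta_mx a a) by rewrite mx1_sum_delta linear_sum.
have le1 := choi_norm_le (@channel_cp _ _ _ E) (@channel_tp _ _ _ E).
have le2 := unital_norm_le (@channel_cp _ _ _ E) (@channel_tp _ _ _ E).
apply: (@le_trans _ _ (\sum_s \sum_t
    (q * (2 ^+ n * \sum_a \sum_a' `|E (delta_mx a a') s t| ^+ 2) +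
     (1 - q) * `|E 1%:M s t| ^+ 2))).
  apply: ler_sum => s _; apply: ler_sum => t _.
  by rewrite sum1 summxE; exact: weighted_coef_le.
under eq_bigr => s _ do rewrite big_split -!mulr_sumr.
rewrite big_split -!mulr_sumr /=.
apply: le_trans (lerD (ler_wpM2l q0 (ler_wpM2l _ le1)) (ler_wpM2l _ le2)) _.
- by rewrite exprn_ge0.
- by rewrite subr_ge0.
by rewrite -natrX mulrnAr expr2 !e4 le_eqVlt; apply/orP; left; apply/eqP; ring.
Qed.

Lemma sum_choi_coef_le (E F : channel R (2 ^ n) 2) :
  \sum_s \sum_t complex.Re (4 ^- n * \sum_mu string_weight q mu *
     (choi_coef E s t mu * choi_coef F s t mu)) <= 1 + complex.Re q.
Proof.
rewrite -lecR.
have qR : (complex.Re q)%:C = q by rewrite RRe_real // ger0_real.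
rewrite rmorphD rmorph1 /= qR -(ler_pM2l (ltr0n C 2)) !rmorph_sum mulr_sumr.
have N0 : 0 <= 4 ^- n :> C by rewrite invr_ge0 exprn_ge0.
apply: (@le_trans _ _ (\sum_s \sum_t 4 ^- n * \sum_mu string_weight q mu *
     (`|choi_coef E s t mu| ^+ 2 + `|choi_coef F s t mu| ^+ 2))).
  apply: ler_sum => s _; rewrite rmorph_sum mulr_sumr; apply: ler_sum => t _ /=.
  (* The factor 2 introduced above turns real parts into [x + x^*], so the estimate stays within the
     order of [C]. *)
  have reE (x : C) : 2 * (complex.Re x)%:C = x + x^* by rewrite -addcJ.
  rewrite reE rmorphM rmorph_sum /=.
  have -> : (4 ^- n : C)^* = 4 ^- n by exact: geC0_conj.
  rewrite -mulrDr ler_wpM2l // -big_split; apply: ler_sum => mu _ /=.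
  have w0 := string_weight_ge0 mu q0.
  rewrite rmorphM /= (geC0_conj w0) -mulrDr ler_wpM2l //.
  move: (choi_coef E s t mu) (choi_coef F s t mu) => x y.
  (* Expanding [|x^* - y|^2 >= 0] separates the two channels. *)
  have := mul_conjC_ge0 (x^* - y); rewrite rmorphB rmorphM /= conjCK !normCK -subr_ge0.
  by congr (0 <= _); ring.
under eq_bigr => s _ do under eq_bigr => t _ do
  (under eq_bigr => mu _ do rewrite mulrDr; rewrite big_split).
under eq_bigr => s _ do rewrite -mulr_sumr big_split.
rewrite -mulr_sumr big_split /= mulrC ler_pdivrMr ?exprn_gt0 //.
apply: le_trans (lerD (weighted_choi_coef_le E) (weighted_choi_coef_le F)) _.
by rewrite le_eqVlt; apply/orP; left; apply/eqP; ring.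
Qed.

End Kernel.

(** Each Pauli term of the input is a product of an Alice entry and a Bob entry, so once the sum
    over strings is outermost the rest factors. *)
Lemma output_pauliE n (p : R) (E F : 'M[C]_(2 ^ n) -> 'M[C]_2) s s' t t' :
  tens_map E F (pairs_power n (rho_depol p)) (mxtens_index (s, s')) (mxtens_index (t, t')) =
  4 ^- n * \sum_mu string_weight (1 - p%:C) mu *
     (choi_coef E s t mu * choi_coef F s' t' mu).
Proof.
rewrite tens_mapE.
under eq_bigr do under eq_bigr do under eq_bigr do under eq_bigr do
  rewrite pairs_power_pauliE -mulrA mulr_suml.
under eq_bigr do under eq_bigr do under eq_bigr do rewrite -mulr_sumr exchange_big.
under eq_bigr do under eq_bigr do rewrite -mulr_sumr exchange_big.
under eq_bigr do rewrite -mulr_sumr exchange_big.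
rewrite -mulr_sumr exchange_big; congr (_ * _); apply: eq_bigr => mu _ /=.
rewrite mulr_suml mulr_sumr; apply: eq_bigr => a _.
rewrite mulr_suml mulr_sumr; apply: eq_bigr => a' _.
rewrite !mulr_sumr; apply: eq_bigr => b _.
rewrite !mulr_sumr; apply: eq_bigr => b' _.
by ring.
Qed.

Lemma ler_sum_term (I : finType) (F : I -> C) i :
  (forall j, 0 <= F j) -> F i <= \sum_j F j.
Proof. by move=> F0; rewrite (bigD1 i) //= lerDl sumr_ge0. Qed.

(** One squared entry is at most the whole Choi norm; the bound is the same for every random string,
    as integrability requires. *)
Lemma choi_entry_le m (E : channel R m 2) a a' s t :
  `|E (delta_mx a a') s t| ^+ 2 <= m%:R *+ 2.
Proof.
apply: le_trans (choi_norm_le (@channel_cp _ _ _ E) (@channel_tp _ _ _ E)).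
pose f s t a a' := `|E (delta_mx a a') s t| ^+ 2.
have f0 x y z w : 0 <= f x y z w by rewrite exprn_ge0.
have f1 x y z : 0 <= \sum_w f x y z w by exact: sumr_ge0.
have f2 x y : 0 <= \sum_z \sum_w f x y z w by exact: sumr_ge0.
have f3 x : 0 <= \sum_y \sum_z \sum_w f x y z w by exact: sumr_ge0.
apply: le_trans (ler_sum_term s f3); apply: le_trans (ler_sum_term t (f2 s)).
by apply: le_trans (ler_sum_term a (f1 s t)); exact: ler_sum_term.
Qed.

Lemma integrable_output n (P : protocol0 R n) (rho : 'M[C]_(2 ^ n * 2 ^ n)) s s' t t' :
  (string_law P).-integrable setT (EFin \o (fun w => complex.Re
    (tens_map (alice P w) (bob P w) rho (mxtens_index (s, s')) (mxtens_index (t, t'))))).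
Proof.
pose M : C := \sum_a \sum_a' \sum_b \sum_b'
  `|rho (mxtens_index (a, b)) (mxtens_index (a', b'))| * ((2 ^ n)%:R *+ 2).
apply: (@integrable_Re _ _ _ _ _ M) => [|w].
  under eq_fun do rewrite tens_mapE.
  do 4 (apply: complex_measurable_sum => ?).
  apply: complex_measurableM; first by split; exact: measurable_cst.
  apply: complex_measurableM; split;
    [exact: alice_meas_Re|exact: alice_meas_Im|exact: bob_meas_Re|exact: bob_meas_Im].
rewrite tens_mapE.
do 4 (apply: le_trans (ler_norm_sum _ _ _) _; apply: ler_sum => ? _).
(* Comparing squares avoids the square root in the bound on each channel entry. *)
rewrite 2!normrM ler_wpM2l // -ler_sqr ?nnegrE ?mulr_ge0 ?mulrn_wge0 ?ler0n //.
by rewrite exprMn [leRHS]expr2 ler_pM ?exprn_ge0 // choi_entry_le.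
Qed.

End Distillation.

Theorem theorem2 (R : realType) (n : nat) (p : R) (P : protocol0 R n)
    (hn : (1 <= n)%N) (hp0 : 0 <= p) (hp1 : p <= 1) :
  model_fidelity (depol_model n p) P <= 1 - p / 2.
Proof.
rewrite /depol_model model_fidelity1 fidelityE.
(* The factor one half comes from the amplitudes of Phi^+; the remaining target [2 - p] is [1 + q]
   with [q = 1 - p]. *)
have -> : 1 - p / 2 = 2^-1 * (2 - p) by field.
rewrite ler_wpM2l ?invr_ge0 ?ler0n //.
under eq_bigr do rewrite mxE /=.
apply: sum_Rintegral_le => [u|w]; first exact: integrable_output.
rewrite -(pair_bigA _ (fun s t => complex.Re (tens_map _ _ _
  (mxtens_index (s, s)) (mxtens_index (t, t))))) /=.
under eq_bigr do under eq_bigr do rewrite output_pauliE.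
have q0 : 0 <= 1 - (p%:C)%C by rewrite subr_ge0 lecR.
have q1 : 1 - (p%:C)%C <= 1 by rewrite gerBl lecR.
apply: le_trans (sum_choi_coef_le q0 q1 _ _) _.
by rewrite /= addrA.
Qed.
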